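(* Let $m,n\ge 0$ be integers and let $\mu=(\mu_1,\ldots,\mu_k)$ be a partition with $\mu_1\ge\cdots\ge\mu_k\ge 0$. Then $$\sum_{\lambda\subseteq(n^m)} f^{(\mu+(n^k))\cup\lambda}\,f^{(\mu+(m^k))\cup\lambda^c} = f^{\mu+((m+n)^k)}\,f^{\mu}\,f^{(n^m)}\cdot\binom{mn+2|\mu|+mk+nk+1}{mn}\cdot\frac{(|\mu|+mk)!\,(|\mu|+nk)!}{(|\mu|+mk+nk)!\,|\mu|!},$$ where the sum runs over all partitions $\lambda$ with at most $m$ parts, each at most $n$, and for such $\lambda$ the partition $\lambda^c$ (with at most $n$ parts) is defined by requiring that the set of parts of the strict partition $\lambda^c+[n]$ is the complement in $\{1,\ldots,m+n\}$ of the set of parts of the strict partition $\lambda+[m]$.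
   Context: A partition $\lambda=(\lambda_1\ge\lambda_2\ge\cdots\ge 0)$ has size $|\lambda|=\sum\lambda_i$; partitions differing only by trailing zeros are identified. Its (ordinary) Young diagram consists of cells $(i,j)$ with $1\le j\le\lambda_i$. A standard Young tableau (SYT) of shape $\lambda$ is a filling of the diagram by $1,\ldots,|\lambda|$, each used once, increasing along rows and down columns; $f^{\lambda}$ denotes their number ($f^{\emptyset}=1$). $(n^m)=(n,\ldots,n)$ ($m$ parts); $[p]=(p,p-1,\ldots,1)$. The sum $\alpha+\beta$ of partitions is taken componentwise after padding with trailing zeros to the same number of parts (here $\lambda$ is padded to $m$ parts and $\lambda^c$ to $n$ parts, and $\mu+(n^k)$ means $(\mu_1+n,\ldots,\mu_k+n)$). For partitions $\alpha,\beta$ with every part of $\alpha$ at least every part of $\beta$, $\alpha\cup\beta$ is the multiset union (parts of $\alpha$ followed by parts of $\beta$). *)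

(* Defs.v *)
From HB Require Import structures.
From mathcomp Require Import all_boot all_order all_algebra.

Set Implicit Arguments.
Unset Strict Implicit.
Unset Printing Implicit Defensive.

(* Partitions are weakly decreasing sequences of naturals, possibly with
   trailing zeros; zero parts contribute no cells, so [nSYT] below does not
   depend on them. *)
Definition is_part (s : seq nat) : bool := sorted geq s.

(* Rows and columns are indexed from 0. *)
Definition cell (s : seq nat) : finType :=
  {i : 'I_(size s) & 'I_(nth 0 s i)}.

Definition row_of (s : seq nat) (c : cell s) : nat := tag c.
Definition col_of (s : seq nat) (c : cell s) : nat := tagged c.

(* The value k of a filling stands for the entry k + 1. *)
Definition is_SYT (s : seq nat) (t : {ffun cell s -> 'I_(sumn s)}) : bool :=
  [&& [forall k, #|[set c | t c == k]| == 1],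
      [forall c, forall d,
         (row_of c == row_of d) && (col_of c < col_of d) ==> (t c < t d)]
    & [forall c, forall d,
         (col_of c == col_of d) && (row_of c < row_of d) ==> (t c < t d)]].

Definition nSYT (s : seq nat) : nat :=
  #|[set t : {ffun cell s -> 'I_(sumn s)} | is_SYT t]|.

Definition rect_part (m n : nat) : seq nat := nseq m n.

Definition stair (p : nat) : seq nat := rev (iota 1 p).

Definition part_add (a b : seq nat) : seq nat :=
  mkseq (fun i => nth 0 a i + nth 0 b i) (maxn (size a) (size b)).

(* [la] is padded to m parts and [lc] to n parts. *)
Definition is_compl (m n : nat) (la lc : seq nat) : Prop :=
  [/\ is_part lc, size lc = n &
      forall x, (x \in part_add lc (stair n)) =
                (1 <= x <= m + n) && (x \notin part_add la (stair m))].

(* [compl_strict m n la] lists the complement of the parts of la + [m] in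
   {1, ..., m + n} in decreasing order. By [part_complP] and [is_compl_inj],
   for a partition la contained in (n^m), [part_compl m n la] is the unique
   sequence satisfying [is_compl m n la]. *)
Definition compl_strict (m n : nat) (la : seq nat) : seq nat :=
  [seq x <- rev (iota 1 (m + n)) | x \notin part_add la (stair m)].

Definition part_compl (m n : nat) (la : seq nat) : seq nat :=
  mkseq (fun i => nth 0 (compl_strict m n la) i - nth 0 (stair n) i) n.

Lemma size_stair p : size (stair p) = p.
Proof. by rewrite size_rev size_iota. Qed.

Lemma nth_stair p i : i < p -> nth 0 (stair p) i = p - i.
Proof.
move=> lt_ip; rewrite nth_rev size_iota // nth_iota;
  last by rewrite ltn_subrL (leq_ltn_trans _ lt_ip).
by rewrite subnS add1n prednK // subn_gt0.
Qed.

Lemma size_part_add_stair p s : size s = p -> size (part_add s (stair p)) = p.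
Proof. by move=> sz; rewrite size_mkseq size_stair sz maxnn. Qed.

Lemma nth_part_add_stair p s i : size s = p -> i < p ->
  nth 0 (part_add s (stair p)) i = nth 0 s i + (p - i).
Proof.
by move=> sz lt_ip; rewrite nth_mkseq ?size_stair ?sz ?maxnn // nth_stair.
Qed.

Lemma geq_tr : transitive geq.
Proof. by move=> y x z /= le_yx le_zy; apply: leq_trans le_yx. Qed.

Lemma gtn_tr : transitive gtn.
Proof. by move=> y x z /= lt_yx lt_zy; apply: ltn_trans lt_yx. Qed.

Lemma gtn_sorted_ge s i : sorted gtn s -> all (leq 1) s ->
  i < size s -> size s - i <= nth 0 s i.
Proof.
elim: s i => [|x s IHs] //= i srt /andP[x_gt0 s_gt0] lt_is.
have srt_s := path_sorted srt.
case: i lt_is => [_|i lt_is] /=; last by rewrite subSS; exact: IHs.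
rewrite subn0; case: s srt srt_s s_gt0 IHs => [|y s] //= /andP[lt_yx _] srt_s s_gt0 IHs.
by have := IHs 0 srt_s s_gt0 isT; rewrite subn0 /= => le_y; exact: leq_ltn_trans le_y lt_yx.
Qed.

Lemma sorted_part_add_stair p s : size s = p -> is_part s ->
  sorted gtn (part_add s (stair p)).
Proof.
move=> sz srt; apply/(sortedP 0) => i; rewrite size_part_add_stair // => lt_ip.
rewrite !nth_part_add_stair //=; last exact: ltnW.
have le_s : nth 0 s i.+1 <= nth 0 s i by apply: (sortedP 0 srt); rewrite sz.
rewrite -addnS leq_add // subnS prednK // subn_gt0; exact: ltnW.
Qed.

Lemma mem_part_add_stair m n s x : size s = m -> all (geq n) s ->
  x \in part_add s (stair m) -> 1 <= x <= m + n.
Proof.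
move=> sz /allP le_n /(nthP 0)[i]; rewrite size_part_add_stair // => lt_im <-.
rewrite nth_part_add_stair //; apply/andP; split.
  by rewrite addn_gt0 subn_gt0 lt_im orbT.
by rewrite addnC leq_add ?leq_subr //; apply: le_n; rewrite mem_nth ?sz.
Qed.

Lemma gtn_sorted_uniq s : sorted gtn s -> uniq s.
Proof. by apply: sorted_uniq; [exact: gtn_tr | move=> x /=; rewrite ltnn]. Qed.

Lemma compl_strict_sorted m n la : sorted gtn (compl_strict m n la).
Proof.
apply: sorted_filter; first exact: gtn_tr.
by rewrite rev_sorted; exact: iota_ltn_sorted.
Qed.

Lemma mem_compl_strict m n la x : (x \in compl_strict m n la) =
  (1 <= x <= m + n) && (x \notin part_add la (stair m)).
Proof. by rewrite mem_filter mem_rev mem_iota add1n ltnS andbC. Qed.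

Lemma size_compl_strict m n la : is_part la -> size la = m -> all (geq n) la ->
  size (compl_strict m n la) = n.
Proof.
move=> srt sz le_n; pose A := part_add la (stair m).
have uA : uniq A by apply/gtn_sorted_uniq/sorted_part_add_stair.
have pA : perm_eq [seq x <- rev (iota 1 (m + n)) | x \in A] A.
  apply: uniq_perm => //; first by rewrite filter_uniq // rev_uniq iota_uniq.
  move=> x; rewrite mem_filter mem_rev mem_iota add1n ltnS.
  by case: (boolP (x \in A)) => //= /(mem_part_add_stair sz le_n).
apply: (@addnI m); rewrite -{1}(size_part_add_stair sz) -(perm_size pA).
rewrite !size_filter -[RHS](size_iota 1) -[RHS]size_rev.
exact: count_predC.
Qed.

Lemma part_add_part_compl m n la : is_part la -> size la = m ->
  all (geq n) la -> part_add (part_compl m n la) (stair n) = compl_strict m n la.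
Proof.
move=> srt sz le_n.
have szc : size (part_compl m n la) = n by rewrite size_mkseq.
have szs := size_compl_strict srt sz le_n.
apply: (@eq_from_nth _ 0); first by rewrite size_part_add_stair.
move=> i; rewrite size_part_add_stair // => lt_in.
rewrite nth_part_add_stair // nth_mkseq // nth_stair // subnK //.
rewrite -{1}szs; apply: gtn_sorted_ge; rewrite ?szs //.
  exact: compl_strict_sorted.
by apply/allP => x; rewrite mem_compl_strict => /andP[/andP[]].
Qed.

Lemma part_complP m n la : is_part la -> size la = m -> all (geq n) la ->
  is_compl m n la (part_compl m n la).
Proof.
move=> srt sz le_n; have szc : size (part_compl m n la) = n by rewrite size_mkseq.
split=> // [|x]; last by rewrite part_add_part_compl // mem_compl_strict.
apply/(sortedP 0) => i; rewrite szc => lt_in /=.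
have := sortedP 0 (compl_strict_sorted m n la) i.
rewrite (size_compl_strict srt sz le_n) => /(_ lt_in) /=.
rewrite -(part_add_part_compl srt sz le_n) !nth_part_add_stair //; last exact: ltnW.
have -> : n - i = (n - i.+1).+1 by rewrite subnS prednK // subn_gt0 ltnW.
by rewrite addnS ltnS leq_add2r.
Qed.

Lemma is_compl_inj m n la lc1 lc2 :
  is_compl m n la lc1 -> is_compl m n la lc2 -> lc1 = lc2.
Proof.
move=> [srt1 sz1 mem1] [srt2 sz2 mem2].
have eqS : part_add lc1 (stair n) = part_add lc2 (stair n).
  apply: (irr_sorted_eq gtn_tr) => [x /=|||x]; rewrite ?ltnn ?mem1 ?mem2 //;
  exact: sorted_part_add_stair.
apply: (@eq_from_nth _ 0) => [|i]; rewrite sz1 // => lt_in.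
apply: (@addIn (n - i)).
by rewrite -!nth_part_add_stair // eqS.
Qed.

(* Main.v *)
Require Import Defs.
From mathcomp Require Import all_boot all_order all_fingroup all_algebra.
From mathcomp Require Import zify ring.

(* For a partition s let l_i = s_i + (size s - i - 1) (0-based), and let W(s) be
   the product of the l_i - l_j (i < j) divided by the product of the l_i!.
   Removing the largest entry of a tableau, together with the identity
     sum_i l_i V(l - e_i) = (sum_i l_i - C(size s, 2)) V(l)
   for the Vandermonde product V, gives f^s = |s|! W(s).

   A partition la in the box (n^m) corresponds to the m-subset X of {0, ..., M-1}
   (M = m + n) formed by its l_i, and la^c to the complement of X. The shapes
   (mu + (n^k)) u la and (mu + (m^k)) u la^c have the l-sequences A u X and
   A u X^c with the same A, the l-sequence of mu shifted by M. Multiplying the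
   two formulas, the cross terms combine into prod_{a in A} a! / (a - M)!, so
   that W W' = W(mu) W(mu + (M^k)) W(la) W(la^c).

   The sum S_t of W(la) W(la^c) over |la| = t satisfies
   (mn - t) S_t = (t + 1) S_{t+1}: adding a cell to la removes one from la^c.
   Hence S_t = f^(n^m) / (t! (mn - t)!), and the convolution
   sum_t C(a + t, t) C(b + N - t, N - t) = C(a + b + N + 1, N) concludes. *)

Set Implicit Arguments.
Unset Strict Implicit.
Unset Printing Implicit Defensive.

Import GRing.Theory Num.Theory.

(** * Tableaux as linear extensions *)

Section LinearExtensions.
Variables (T : finType) (lt : rel T) (M : nat).
Implicit Types (D : {set T}) (f : {ffun T -> 'I_M.+1}).

(* [f x] is the 1-based position of [x] in the extension, and 0 off [D]; [M] is
   only an ambient bound, so that extensions of all subsets share one type. *)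
Definition is_linext D f : bool :=
  [&& [forall x, (x \in D) == (0 < f x)], [forall x, f x <= #|D|],
      [forall x in D, forall y in D, (f x == f y) ==> (x == y)]
    & [forall x in D, forall y in D, lt x y ==> (f x < f y)]].

Lemma is_linextP D f :
  reflect [/\ forall x, (x \in D) = (0 < f x), forall x, f x <= #|D|,
              {in D &, injective f} & {in D &, forall x y, lt x y -> f x < f y}]
          (is_linext D f).
Proof.
apply: (iffP and4P) => -[supp le_card inj homo]; split.
- by move=> x; apply/eqP/(forallP supp).
- by move=> x; apply/(forallP le_card).
- move=> x y xD yD /eqP fxy.
  by apply/eqP; apply: implyP fxy; apply: (forall_inP (forall_inP inj x xD)).
- by move=> x y xD yD; apply/implyP/(forall_inP (forall_inP homo x xD)).
- by apply/forallP=> x; apply/eqP.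
- exact/forallP.
- apply/forall_inP=> x xD; apply/forall_inP=> y yD; apply/implyP=> /eqP fxy.
  exact/eqP/inj.
- apply/forall_inP=> x xD; apply/forall_inP=> y yD; apply/implyP; exact: homo.
Qed.

Definition nlinext D : nat := #|[set f | is_linext D f]|.

Lemma nlinext0 : nlinext set0 = 1.
Proof.
rewrite /nlinext (_ : [set f | _] = [set [ffun => ord0]]) ?cards1 //.
apply/setP=> f; rewrite !inE; apply/is_linextP/eqP => [[supp _ _ _]|->].
  by apply/ffunP=> x; apply/val_inj; rewrite ffunE /=; have := supp x; rewrite inE; lia.
by split=> x; rewrite ?ffunE ?inE.
Qed.

(** The values on D are [#|D|] distinct positive numbers bounded by [#|D|], so by counting they
    exhaust {1, ..., [#|D|]}. *)
Lemma linext_top D f : 0 < #|D| -> is_linext D f ->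
  exists2 x, x \in D & f x = #|D| :> nat.
Proof.
move=> D_gt0 /is_linextP[supp le_card inj _].
pose g x : nat := (f x).-1.
have inj_g : {in D &, injective g}.
  rewrite /g => x y xD yD eq_g; apply: inj => //; apply/val_inj => /=.
  by move: xD yD; rewrite !supp; lia.
have ug : uniq (map g (enum D)).
  by rewrite map_inj_in_uniq ?enum_uniq // => x y; rewrite !mem_enum; exact: inj_g.
have sub : {subset map g (enum D) <= iota 0 #|D|}.
  move=> ? /mapP[x]; rewrite mem_enum mem_iota => xD ->.
  by have := le_card x; move: xD; rewrite supp /g; lia.
have [|_ eq_mem] := uniq_min_size ug sub.
  by rewrite size_iota size_map -cardE.
have : #|D|.-1 \in iota 0 #|D| by rewrite mem_iota; lia.
rewrite -eq_mem => /mapP[x]; rewrite mem_enum => xD eq_g; exists x => //.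
by move: xD eq_g; rewrite supp /g; lia.
Qed.

(** [down] erases the top entry at x and [up] restores it; as x is maximal, no order constraint
    opposes giving it the top value. *)
Lemma nlinext_extend D x : #|D| <= M -> x \in D ->
    [forall y in D, ~~ lt x y] ->
  \sum_(f | is_linext D f && (f x == #|D| :> nat)) 1 = nlinext (D :\ x).
Proof.
move=> le_DM xD /forall_inP maxx; rewrite /nlinext -[RHS]sum1dep_card.
pose up (g : {ffun T -> 'I_M.+1}) := [ffun z => if z == x then inord #|D| else g z].
pose down (f : {ffun T -> 'I_M.+1}) := [ffun z => if z == x then ord0 else f z].
have cDx : #|D| = #|D :\ x|.+1 by rewrite (cardsD1 x) xD.
rewrite (reindex_onto up down) => [|f /andP[_ /eqP fx]]; last first.
  apply/ffunP=> z; rewrite !ffunE; case: eqP => // ->.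
  by rewrite -fx; apply/val_inj; rewrite /= inordK.
apply: eq_bigl => g; rewrite ffunE eqxx inordK // eqxx andbT.
(* The round trip condition only says that g vanishes at x, which holds for all extensions of
   [D :\ x]. *)
apply/andP/idP => [[/is_linextP[supp le_card inj homo] /eqP def_g]|].
  have ne z : z \in D :\ x -> [/\ z != x, z \in D & up g z = g z].
    by rewrite !inE ffunE => /andP[/negPf->].
  have gx : g x = ord0 by rewrite -def_g !ffunE eqxx.
  have upx : up g x = #|D| :> nat by rewrite ffunE eqxx inordK.
  apply/is_linextP; split.
  - move=> z; rewrite !inE; case: (eqVneq z x) => [->|nzx] /=; first by rewrite gx.
    by rewrite supp ffunE (negPf nzx).
  - move=> z; have [->|nzx] := eqVneq z x; first by rewrite gx.
    have := le_card z; rewrite leq_eqVlt cDx ltnS => /orP[/eqP eq_z|].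
      have zD : z \in D by rewrite supp eq_z.
      case/eqP: nzx; apply: inj => //; apply/val_inj => /=.
      by rewrite eq_z upx.
    by rewrite ffunE (negPf nzx).
  - move=> y z /ne[_ yD <-] /ne[_ zD <-]; exact: inj.
  - move=> y z /ne[_ yD <-] /ne[_ zD <-]; exact: homo.
move=> /is_linextP[supp le_card inj homo].
have gx : g x = ord0 by apply/val_inj; have := supp x; rewrite !inE eqxx /=; lia.
split; last first.
  by apply/eqP/ffunP=> z; rewrite !ffunE; case: eqP => // ->.
have upE z : up g z = (if z == x then #|D| else g z) :> nat.
  by rewrite ffunE; case: ifP; rewrite // inordK.
have lt_g z : g z < #|D| by rewrite cDx ltnS.
apply/is_linextP; split.
- move=> z; rewrite upE; case: eqP => [->|/eqP nzx]; first by rewrite xD cDx.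
  by rewrite -supp !inE nzx.
- by move=> z; rewrite upE; case: eqP => // _; apply: ltnW.
- move=> y z yD zD /(congr1 val) /=; rewrite !upE.
  have := lt_g y; have := lt_g z.
  case: eqP => [->|/eqP nyx]; case: eqP => [->|/eqP nzx] //; try lia.
  by move=> _ _ /val_inj; apply: inj; rewrite !inE ?nyx ?nzx.
- move=> y z yD zD lt_yz; rewrite !upE.
  case: eqP lt_yz => [->|/eqP nyx] lt_yz; first by case/negP: (maxx z zD).
  case: eqP lt_yz => [->|/eqP nzx] lt_yz; first exact: lt_g.
  by apply: homo; rewrite ?inE ?nyx ?nzx.
Qed.

(** Extensions are classified by the element in the top position, which must be maximal. *)
Lemma nlinext_rec D : 0 < #|D| <= M ->
  nlinext D = \sum_(x in D | [forall y in D, ~~ lt x y]) nlinext (D :\ x).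
Proof.
move=> /andP[D_gt0 le_DM].
rewrite {1}/nlinext -sum1dep_card.
transitivity (\sum_(f | is_linext D f) \sum_(x in D | f x == #|D| :> nat) 1).
  apply: eq_bigr => f linf; have [x xD fx] := linext_top D_gt0 linf.
  rewrite (big_pred1 x) // => y /=; apply/andP/eqP => [[yD /eqP fy]|->].
    have /is_linextP[_ _ inj _] := linf.
    by apply: inj => //; apply/val_inj; rewrite /= fx fy.
  by rewrite xD fx.
rewrite (exchange_big_dep (mem D)) /=; last by move=> f x _ /andP[].
rewrite [RHS]big_mkcondr; apply: eq_bigr => x xD.
transitivity (\sum_(f | is_linext D f && (f x == #|D| :> nat)) 1).
  by apply: eq_bigl => f; rewrite xD.
case: ifPn => [maxx|/forall_inPn[y yD]]; first exact: nlinext_extend.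
rewrite negbK => lt_xy; apply: big1 => f /andP[/is_linextP[_ le_card _ homo] /eqP fx].
by have := homo _ _ xD yD lt_xy; rewrite fx ltnNge le_card.
Qed.

End LinearExtensions.

(** * Young diagrams and removal of a corner *)

Definition diagram (p q : nat) (s : seq nat) : {set 'I_p * 'I_q} :=
  [set x : 'I_p * 'I_q | x.2 < nth 0 s x.1].

Definition cell_lt (p q : nat) : rel ('I_p * 'I_q) := fun x y =>
  (x.1 == y.1) && (x.2 < y.2) || (x.2 == y.2) && (x.1 < y.1).

Lemma card_cell s : #|{: cell s}| = sumn s.
Proof.
rewrite card_tagged !sumnE [RHS](big_nth 0) big_mkord big_map enumT.
by apply: eq_bigr => i _; rewrite card_ord.
Qed.

(** A tableau t becomes the extension with value t + 1 on the cells and 0 outside. The ambient p, q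
    and M are free, so that a shape and its one-cell reductions can be counted in one type. *)
Lemma nSYT_nlinext p q M s : size s = p -> all (geq q) s -> sumn s <= M ->
  nSYT s = nlinext (@cell_lt p q) M (diagram p q s) /\ #|diagram p q s| = sumn s.
Proof.
move=> size_s /allP s_le_q le_sM.
have emb_row (c : cell s) : row_of c < p by rewrite -size_s ltn_ord.
have emb_col (c : cell s) : col_of c < q.
  by apply: leq_trans (ltn_ord _) _; apply: s_le_q; apply: mem_nth.
pose emb (c : cell s) : 'I_p * 'I_q := (Ordinal (emb_row c), Ordinal (emb_col c)).
have emb_inj : injective emb.
  move=> [i j] [i' j'] [/val_inj/= ii' ]; case: i' / ii' j' => j' jj'.
  by congr Tagged; apply/val_inj.
have emb_diag c : emb c \in diagram p q s by rewrite inE /=; apply: ltn_ord.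
have embP x : x \in diagram p q s -> exists c, emb c = x.
  case: x => i j; rewrite inE /= => lt_j.
  have lt_i : i < size s by rewrite size_s.
  exists (Tagged (fun i : 'I_(size s) => 'I_(nth 0 s i)) (Ordinal (lt_j : j < nth 0 s (Ordinal lt_i)))).
  by congr pair; apply/val_inj.
have cdiag : #|diagram p q s| = sumn s.
  rewrite -card_cell -(card_imset _ emb_inj); apply: eq_card => x.
  apply/idP/imsetP => [/embP[c <-]|[c _ ->]]; last exact: emb_diag.
  by exists c.
split=> //.
pose ext (t : {ffun cell s -> 'I_(sumn s)}) : {ffun 'I_p * 'I_q -> 'I_M.+1} :=
  [ffun x => if [pick c | emb c == x] is Some c then inord (t c).+1 else ord0].
have ext_emb t c : ext t (emb c) = (t c).+1 :> nat.
  rewrite ffunE; case: pickP => [c' /eqP/emb_inj->|/(_ c)]; last by rewrite eqxx.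
  by rewrite inordK // ltnS (leq_trans _ le_sM).
have ext_out t x : x \notin diagram p q s -> ext t x = ord0.
  move=> xD; rewrite ffunE; case: pickP => [c /eqP def_x|//].
  by rewrite -def_x emb_diag in xD.
have ext_inj : injective ext.
  move=> t t' eq_ext; apply/ffunP=> c; apply/val_inj/succn_inj => /=.
  by rewrite -!ext_emb eq_ext.
rewrite /nSYT -(card_imset _ ext_inj) /nlinext; apply: eq_card => f.
rewrite inE; apply/imsetP/is_linextP => [[t]|[supp le_card inj homo]].
  rewrite inE => /and3P[bij row col] ->; split=> [x|x|x y|x y].
  - have [/embP[c <-]|xD] := boolP (x \in _); last by rewrite ext_out.
    by rewrite ext_emb.
  - have [/embP[c <-]|xD] := boolP (x \in diagram p q s); last by rewrite ext_out.
    by rewrite ext_emb cdiag.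
  - move=> /embP[c <-] /embP[d <-] /(congr1 val) /=; rewrite !ext_emb.
    case=> /val_inj tcd; have := forallP bij (t c) => /cards1P[e def_e].
    have: c \in [set e] by rewrite -def_e inE.
    have: d \in [set e] by rewrite -def_e inE tcd.
    by rewrite !inE => /eqP-> /eqP->.
  - move=> /embP[c <-] /embP[d <-]; rewrite !ext_emb ltnS /cell_lt /=.
    rewrite -!val_eqE /= => /orP[lt_cd|lt_cd].
      by apply: implyP lt_cd; apply: (forallP (forallP row c)).
    by apply: implyP lt_cd; apply: (forallP (forallP col c)).
have lt_f c : (f (emb c)).-1 < sumn s.
  by rewrite -cdiag prednK ?le_card // -supp emb_diag.
pose t := [ffun c => Ordinal (lt_f c)].
have tS c : (t c).+1 = f (emb c).
  by rewrite ffunE /= prednK // -supp emb_diag.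
have t_inj : injective t.
  move=> c d /(congr1 val)/(congr1 S) /=; rewrite !tS => /val_inj.
  by move=> /inj-/(_ (emb_diag c) (emb_diag d))/emb_inj.
have def_f : f = ext t.
  apply/ffunP=> x; apply/val_inj => /=.
  have [/embP[c <-]|xD] := boolP (x \in diagram p q s); first by rewrite ext_emb tS.
  by rewrite ext_out //=; move: xD; rewrite supp -eqn0Ngt => /eqP.
exists t => //; rewrite inE; apply/and3P; split.
(* An injection between sets of equal cardinality is a bijection, so each fibre is a singleton. *)
- have [u tK uK] := inj_card_bij t_inj (eq_leq (etrans (card_ord _) (esym (card_cell s)))).
  apply/forallP=> k; rewrite (_ : [set c | _] = [set u k]) ?cards1 //.
  by apply/setP=> c; rewrite !inE; apply/eqP/eqP => [<-|->].
- apply/forallP=> c; apply/forallP=> d; apply/implyP=> lt_cd.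
  rewrite -ltnS !tS; apply: homo; rewrite ?emb_diag // /cell_lt -!val_eqE /=.
  by rewrite lt_cd.
- apply/forallP=> c; apply/forallP=> d; apply/implyP=> lt_cd.
  rewrite -ltnS !tS; apply: homo; rewrite ?emb_diag // /cell_lt -!val_eqE /=.
  by rewrite lt_cd orbT.
Qed.

Definition decr (s : seq nat) (i : nat) : seq nat := set_nth 0 s i (nth 0 s i).-1.

Lemma size_decr s i : i < size s -> size (decr s i) = size s.
Proof. by move=> lt_is; rewrite size_set_nth; apply/maxn_idPr. Qed.

Lemma nth_decr s i j : nth 0 (decr s i) j = nth 0 s j - (j == i).
Proof. by rewrite nth_set_nth /=; case: eqP => [->|]; rewrite ?subn1 ?subn0. Qed.

Lemma leq_nth_sumn s i : nth 0 s i <= sumn s.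
Proof.
elim: s i => [|x s IHs] [|i] //=; first exact: leq_addr.
exact: leq_trans (IHs i) (leq_addl _ _).
Qed.

Lemma sumn_decr s i : 0 < nth 0 s i -> sumn s = (sumn (decr s i)).+1.
Proof.
move=> s_gt0; have lt_is : i < size s by rewrite ltnNge; apply: contraL s_gt0 => /(nth_default 0)->.
by have := leq_nth_sumn s i; rewrite /decr sumn_set_nth0; lia.
Qed.

(** Rows past the end read as 0, so the last row is a corner as soon as it is nonempty. *)
Definition corner (s : seq nat) (i : nat) : bool := nth 0 s i.+1 < nth 0 s i.

Lemma is_part_nth s i : is_part s -> nth 0 s i.+1 <= nth 0 s i.
Proof.
move=> srt; have [lt_is|le_si] := ltnP i.+1 (size s); first exact: (sortedP 0 srt).
by rewrite nth_default.
Qed.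

Lemma is_part_decr s i : is_part s -> corner s i -> is_part (decr s i).
Proof.
move=> srt cor_i; have lt_is : i < size s.
  by rewrite ltnNge; apply: contraL cor_i => le_si; rewrite /corner (nth_default _ le_si).
apply/(sortedP 0) => j _ /=; rewrite !nth_decr.
have := is_part_nth j srt; move: cor_i; rewrite /corner.
by case: (eqVneq j i) => [->|_]; lia.
Qed.

(** The largest entry occupies a maximal cell of the diagram, and the maximal cells are the ends of
    the corner rows. *)
Lemma nSYT_rec s : is_part s -> 0 < sumn s ->
  nSYT s = \sum_(i < size s | corner s i) nSYT (decr s i).
Proof.
move=> srt s_gt0; set p := size s; pose q := sumn s.
have nth_q i : nth 0 s i <= q := leq_nth_sumn s i.
have all_q r : (forall i, nth 0 r i <= q) -> all (geq q.+1) r.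
  by move=> le_r; apply/(all_nthP 0) => i _ /=; apply: leqW.
have [-> cardD] := @nSYT_nlinext p q.+1 q s erefl (all_q s nth_q) (leqnn _).
rewrite nlinext_rec ?cardD ?s_gt0 ?leqnn //.
(* [h i] is the end of row i when that row is nonempty; the extra column gives [inord] an inhabited
   type. *)
pose h (i : 'I_p) : 'I_p * 'I_q.+1 := (i, inord (nth 0 s i).-1).
have h2 i : (inord (nth 0 s i).-1 : 'I_q.+1) = (nth 0 s i).-1 :> nat.
  by rewrite inordK // ltnS; have := nth_q i; lia.
rewrite (reindex_onto h fst) /= => [|[i j]]; last first.
  rewrite inE /= => /andP[lt_j /forall_inP maxx]; congr pair; apply/val_inj.
  rewrite /= h2; apply/eqP; rewrite eqn_leq; apply/andP; split; last by lia.
  (* Otherwise the right neighbour of (i, j) would lie in the diagram. *)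
  rewrite leqNgt; apply/negP=> lt_j'.
  have lt_jq : j.+1 < q.+1 by have := nth_q i; lia.
  have := maxx (i, Ordinal lt_jq); rewrite inE /cell_lt /= eqxx ltnSn /=.
  have -> : j.+1 < nth 0 s i by lia.
  by move/(_ isT).
rewrite (eq_bigl (fun i : 'I_p => corner s i)) => [|i].
  apply: eq_bigr => i cor_i; have s_i_gt0 : 0 < nth 0 s i by exact: leq_ltn_trans cor_i.
  have nth_dq j : nth 0 (decr s i) j <= q.
    by rewrite nth_decr; apply: leq_trans (leq_subr _ _) (nth_q j).
  have sum_d := sumn_decr s_i_gt0.
  have le_d : sumn (decr s i) <= q by rewrite /q sum_d.
  have [-> _] := @nSYT_nlinext p q.+1 q _ (size_decr (ltn_ord i)) (all_q _ nth_dq) le_d.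
  congr nlinext; apply/setP => -[i' j']; rewrite !inE -pair_eqE /= nth_decr -!val_eqE /= h2.
  by case: (eqVneq (i' : nat) i) => [->|_] /=; lia.
rewrite eqxx andbT inE /= h2.
apply/andP/idP => [[lt_i /forall_inP maxx]|cor_i].
  (* Otherwise the cell below the end of row i would lie in the diagram. *)
  rewrite /corner ltnNge; apply/negP=> le_i.
  have lt_ip : i.+1 < p by rewrite ltnNge; apply/negP => ?; move: le_i; rewrite [nth _ _ i.+1]nth_default //; lia.
  have := maxx (Ordinal lt_ip, (h i).2); rewrite inE /cell_lt /= h2 eqxx ltnSn orbT.
  have -> : (nth 0 s i).-1 < nth 0 s i.+1 by lia.
  by move/(_ isT).
move: cor_i; rewrite /corner => cor_i; split; first by lia.
apply/forall_inP => -[i' j']; rewrite inE /cell_lt h2 -!val_eqE /= h2 => lt_j'.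
apply/negP=> /orP[/andP[/eqP eq_i]|/andP[/eqP eq_j lt_i]].
  by rewrite -eq_i in lt_j'; lia.
(* The rows below i are no longer than row i + 1, hence too short to reach the column of [h i]. *)
have le_i : nth 0 s i' <= nth 0 s i.+1.
  elim: (i' : nat) lt_i {eq_j lt_j'} => // k IHk; rewrite ltnS leq_eqVlt.
  case/orP => [/eqP->//|/IHk]; apply: leq_trans; exact: is_part_nth.
by lia.
Qed.

(** * The Frobenius formula *)

Local Open Scope ring_scope.

Section Vandermonde.
Variable R : comNzRingType.

Definition rising (i : nat) (y : R) : R := \prod_(k < i) (y + k%:R).

(** Both sides are y (y + 1) ... (y + i). This behaviour under a unit shift is why rising factorials
    replace powers below. *)
Lemma rising_shift i (y : R) : y * rising i (y + 1) = (y + i%:R) * rising i y.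
Proof.
rewrite [RHS]mulrC /rising -(big_ord_recr i (fun k : 'I_i.+1 => y + k%:R)) /=.
rewrite big_ord_recl addr0; congr (_ * _); apply: eq_bigr => k _.
by rewrite /bump /= natrD addrA.
Qed.

Definition vandermonde_prod (p : nat) (y : nat -> R) : R :=
  \prod_(i < p) \prod_(j < p | (i < j)%N) (y j - y i).

(** The rising factorials are monic of degree i, so the change of basis from the powers is
    unitriangular and preserves the Vandermonde determinant. *)
Lemma det_rising p (y : nat -> R) :
  \det (\matrix_(i < p, j < p) rising i (y j)) = vandermonde_prod p y.
Proof.
pose P (i : nat) : {poly R} := \prod_(k < i) ('X - (- k%:R)%:P).
have size_P i : size (P i) = i.+1 by rewrite /P size_prod_XsubC /index_enum -enumT size_enum_ord.
have P_monic i : P i \is monic by exact: monic_prod_XsubC.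
pose L := \matrix_(i < p, k < p) (P i)`_k.
have -> : \matrix_(i < p, j < p) rising i (y j) = L *m Vandermonde p (\row_j y j).
  apply/matrixP=> i j; rewrite !mxE.
  transitivity (P i).[y j].
    by rewrite horner_prod; apply: eq_bigr => k _; rewrite hornerXsubC opprK.
  rewrite (@horner_coef_wide _ p) ?size_P //.
  by apply: eq_bigr => k _; rewrite !mxE.
have trigL : is_trig_mx L.
  by apply/is_trig_mxP => i k lt_ik; rewrite mxE nth_default // size_P.
rewrite det_mulmx det_trig // big1 => [|i _]; last first.
  by rewrite mxE; have /monicP := P_monic i; rewrite lead_coefE size_P.
rewrite mul1r det_Vandermonde; apply: eq_bigr => i _; apply: eq_bigr => j _.
by rewrite !mxE.
Qed.

(* Expand the determinant of the rising factorials [rising i (y j)]: replacing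
   y_j by y_j + 1 and multiplying by y_j scales the term of a permutation s by
   y_j + s^-1 j, and summing these factors over j does not depend on s. *)
Lemma vandermonde_prod_shift p (y : nat -> R) :
  \sum_(j < p) y j * vandermonde_prod p (fun k => y k + (k == j)%:R) =
  (\sum_(j < p) y j + \sum_(j < p) (j : nat)%:R) * vandermonde_prod p y.
Proof.
under eq_bigr => j _ do rewrite -det_rising /determinant mulr_sumr.
rewrite exchange_big -det_rising /determinant mulr_sumr; apply: eq_bigr => s _ /=.
rewrite mulrCA; under eq_bigr => j _ do rewrite mulrCA.
rewrite -mulr_sumr; congr (_ * _).
under [X in _ = _ * X]eq_bigr => i _ do rewrite mxE.
rewrite [X in _ + X](reindex_perm s^-1%g) /=.
rewrite -big_split mulr_suml; apply: eq_bigr => j _ /=.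
(* The variable y_j occurs only in row s^-1 j, where [rising_shift] applies. *)
rewrite [in LHS](bigD1 (s^-1 j)%g) //= [in RHS](bigD1 (s^-1 j)%g) //= !mxE permKV eqxx.
rewrite mulrA rising_shift -mulrA; congr (_ * _); congr (_ * _).
apply: eq_bigr => i ne_i; rewrite mxE (_ : (s i == j :> nat) = false) ?addr0 //.
by apply/negbTE; apply: contra ne_i => /eqP/val_inj <-; rewrite permK.
Qed.

End Vandermonde.

(** * Vandermonde products and weights of integer sequences *)

Fixpoint vdm (l : seq nat) : rat :=
  if l is x :: l' then \prod_(y <- l') (x%:R - y%:R) * vdm l' else 1.

(** Negating the entries gives the factors l_i - l_j with i < j, and turns the unit shift of
    [vandermonde_prod_shift] into a decrement. *)
Lemma vdm_vandermonde_prod l :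
  vdm l = vandermonde_prod (size l) (fun i => - (nth 0%N l i)%:R).
Proof.
rewrite /vandermonde_prod; elim: l => [|x l IHl]; first by rewrite big_ord0.
rewrite /= big_ord_recl; congr (_ * _).
  rewrite [RHS]big_mkcond [RHS]big_ord_recl /= mul1r (big_nth 0%N) big_mkord.
  by apply: eq_bigr => i _; rewrite /= addrC opprK.
rewrite IHl; apply: eq_bigr => i _; rewrite [RHS]big_mkcond big_ord_recl /= mul1r.
by rewrite [LHS]big_mkcond; apply: eq_bigr => j _.
Qed.

(** This is [vandermonde_prod_shift] at y_i = - l_i; the binomial coefficient is the sum of the
    indices. *)
Lemma vdm_decr (l : seq nat) :
  \sum_(i < size l) (nth 0%N l i)%:R * vdm (decr l i) =
  ((sumn l)%:R - 'C(size l, 2)%:R) * vdm l.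
Proof.
pose y i : rat := - (nth 0%N l i)%:R.
have := vandermonde_prod_shift (size l) y; rewrite -vdm_vandermonde_prod.
rewrite sumrN -!natr_sum -bin2_sum big_mkord [sumn l]sumnE (big_nth 0%N) big_mkord.
move=> shift; rewrite -[RHS]opprK -mulNr opprB [_ - _]addrC -shift -sumrN.
apply: eq_bigr => i _; rewrite /y mulNr opprK.
(* Decrementing 0 is truncated, but then the coefficient l_i vanishes. *)
case: (posnP (nth 0%N l i)) => [->|l_gt0]; first by rewrite !mul0r.
congr (_ * _); rewrite vdm_vandermonde_prod size_decr // /vandermonde_prod.
apply: eq_bigr => j _; apply: eq_bigr => k _; rewrite !nth_decr.
have nat_decr m : (nth 0%N l m - (m == i))%:R = (nth 0%N l m)%:R - (m == i)%:R :> rat.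
  by rewrite natrB //; case: eqP => // ->.
by rewrite !nat_decr; ring.
Qed.

Definition weight (l : seq nat) : rat := vdm l / \prod_(x <- l) (x`!)%:R.

Lemma natr_fact_neq0 k : (k`!)%:R != 0 :> rat.
Proof. by rewrite pnatr_eq0 -lt0n fact_gt0. Qed.

Lemma prod_fact_neq0 (l : seq nat) : \prod_(x <- l) (x`!)%:R != 0 :> rat.
Proof. by rewrite prodf_seq_neq0; apply/allP => x _ /=; exact: natr_fact_neq0. Qed.

Lemma prod_fact_decr l i : (0 < nth 0%N l i)%N ->
  \prod_(x <- l) (x`!)%:R = (nth 0%N l i)%:R * \prod_(x <- decr l i) (x`!)%:R :> rat.
Proof.
elim: l i => [|x l IHl] [|i] //= l_gt0; rewrite /decr /= !big_cons.
  by rewrite mulrA -natrM -{1 2}(prednK l_gt0) factS.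
by rewrite (IHl i) // mulrCA.
Qed.

(** Lowering l_i removes a factor l_i from the product of factorials, which absorbs the coefficient
    in [vdm_decr]. *)
Lemma weight_decr (l : seq nat) :
  \sum_(i < size l | (0 < nth 0%N l i)%N) weight (decr l i) =
  ((sumn l)%:R - 'C(size l, 2)%:R) * weight l.
Proof.
rewrite /weight mulrA -vdm_decr mulr_suml big_mkcond; apply: eq_bigr => i _.
case: posnP => [->|l_gt0]; first by rewrite !mul0r.
rewrite (prod_fact_decr l_gt0) invfM mulrACA divff ?mul1r //.
by rewrite pnatr_eq0 -lt0n.
Qed.

Lemma vdm_eq0 l : ~~ uniq l -> vdm l = 0.
Proof.
elim: l => //= x l IHl; rewrite negb_and negbK => /orP[x_l|/IHl->]; last by rewrite mulr0.
by rewrite (big_rem x x_l) /= subrr !mul0r.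
Qed.

Lemma weight_eq0 l : ~~ uniq l -> weight l = 0.
Proof. by move=> l_nuniq; rewrite /weight vdm_eq0 ?mul0r. Qed.

(** * The l-sequences, or beta-numbers, of partitions *)

Fixpoint beta (s : seq nat) : seq nat :=
  if s is x :: s' then (x + size s')%N :: beta s' else [::].

Lemma size_beta s : size (beta s) = size s.
Proof. by elim: s => //= x s ->. Qed.

Lemma nth_beta s i : (i < size s)%N -> nth 0%N (beta s) i = (nth 0%N s i + (size s - i.+1))%N.
Proof. by elim: s i => //= x s IHs [|i] lt_i //=; rewrite ?subn1 // IHs. Qed.

Lemma sumn_beta s : sumn (beta s) = (sumn s + 'C(size s, 2))%N.
Proof. by elim: s => //= x s ->; rewrite binS bin1 addnACA [('C(_, _) + _)%N]addnC. Qed.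

Lemma beta_decr s i : (0 < nth 0%N s i)%N -> beta (decr s i) = decr (beta s) i.
Proof.
elim: s i => [|x s IHs] [|i] //= s_gt0; rewrite /decr /=; first by congr cons; lia.
have lt_is : (i < size s)%N by rewrite ltnNge; apply: contraL s_gt0 => /(nth_default 0%N)->.
by congr cons; [rewrite (size_decr lt_is) | exact: IHs].
Qed.

(** If row i is not a corner then l_i = l_{i+1} + 1, so lowering l_i creates a repeated entry. *)
Lemma weight_beta_noncorner s i : is_part s -> (i < size s)%N ->
    (0 < nth 0%N (beta s) i)%N -> ~~ corner s i ->
  weight (decr (beta s) i) = 0.
Proof.
move=> srt lt_is; rewrite nth_beta // /corner -leqNgt => b_gt0 le_i.
have eq_i : nth 0%N s i = nth 0%N s i.+1 by have := is_part_nth i srt; lia.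
(* In the last row l_i = s_i, so a positive l_i would make this row a corner. *)
have lt_Sis : (i.+1 < size s)%N.
  by rewrite ltnNge; apply/negP=> le_si; move: b_gt0; rewrite eq_i nth_default; lia.
apply: weight_eq0; apply/negP=> /(uniqP 0%N)/(_ i i.+1).
rewrite !inE size_decr ?size_beta // => /(_ lt_is lt_Sis).
rewrite !nth_decr !nth_beta // eq_i eqxx; case: (eqVneq i.+1 i); first lia.
move=> _ inj; suff: i = i.+1 by lia.
apply: inj; lia.
Qed.

(** The l-sequence of the padded empty partition is p - 1, ..., 0, and the differences of an entry x
    with the later ones multiply to x!. *)
Lemma weight_staircase p : weight (beta (nseq p 0%N)) = 1.
Proof.
have beta_nseq r : beta (nseq r 0%N) = rev (iota 0 r).
  elim: r => // r IHr; rewrite -[in RHS]addn1 iotaD rev_cat -IHr /=.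
  by rewrite size_nseq.
rewrite /weight; elim: p => [|p IHp]; first by rewrite /= big_nil divr1.
rewrite /= big_cons size_nseq add0n invfM mulrACA IHp mulr1.
rewrite beta_nseq big_rev /= -[p in iota 0 p]subn0 -/(index_iota 0 p) big_mkord.
suff -> : \prod_(i < p) (p%:R - (i : nat)%:R) = (p`!)%:R :> rat.
  by rewrite divff ?natr_fact_neq0.
rewrite fact_prod big_add1 big_mkord natr_prod (reindex_inj rev_ord_inj).
apply: eq_bigr => i _ /=.
by rewrite -natrB ?leq_subr // subKn.
Qed.

Lemma sumn0_nseq s : sumn s = 0%N -> s = nseq (size s) 0%N.
Proof.
move=> sum_s; apply/all_pred1P/(all_nthP 0%N) => i _ /=; rewrite -leqn0.
by have := leq_nth_sumn s i; rewrite sum_s.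
Qed.

(* Frobenius' form of the hook length formula. *)
Theorem nSYT_weight s : is_part s ->
  (nSYT s)%:R = ((sumn s)`!)%:R * weight (beta s).
Proof.
move: {2}(sumn s) (erefl (sumn s)) => N; elim: N s => [|N IHN] s sum_s srt.
  have def_s := sumn0_nseq sum_s.
  have all_s : all (geq 0%N) s.
    by apply/(all_nthP 0%N) => i _ /=; have := leq_nth_sumn s i; rewrite sum_s.
  have [-> cardD] := @nSYT_nlinext (size s) 0 0 s erefl all_s (eq_leq sum_s).
  move/eqP: cardD; rewrite sum_s cards_eq0 => /eqP->.
  by rewrite nlinext0 def_s weight_staircase mulr1.
rewrite nSYT_rec ?sum_s // natr_sum factS natrM mulrAC mulrC.
(* The size of s is exactly the coefficient in [weight_decr] for its l-sequence. *)
have -> : N.+1%:R = (sumn (beta s))%:R - 'C(size (beta s), 2)%:R :> rat.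
  by rewrite sumn_beta size_beta natrD addrK sum_s.
rewrite -weight_decr mulr_sumr size_beta.
(* One sum runs over the corners, the other over the positive l_i: corners have l_i > 0, and the
   extra terms vanish. *)
rewrite big_mkcond [RHS]big_mkcond; apply: eq_bigr => i _.
case: ifPn => [cor_i|ncor_i].
  have s_gt0 : (0 < nth 0%N s i)%N by apply: leq_ltn_trans cor_i.
  have := sumn_decr s_gt0; rewrite sum_s => -[sum_d].
  rewrite nth_beta // ltn_addr // IHN ?is_part_decr // -sum_d beta_decr //.
case: ifP => // b_gt0; rewrite weight_beta_noncorner ?mulr0 //.
Qed.

(** * Partitions in a box as subsets *)

(** The decreasing order is the one of [beta], on which the sign of [vdm] depends. *)
Definition desc M (X : {set 'I_M}) : seq nat := rev (map val (enum X)).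

Lemma size_desc M (X : {set 'I_M}) : size (desc X) = #|X|.
Proof. by rewrite size_rev size_map -cardE. Qed.

Lemma mem_desc M (X : {set 'I_M}) (x : 'I_M) : ((x : nat) \in desc X) = (x \in X).
Proof. by rewrite mem_rev (mem_map val_inj) mem_enum. Qed.

Lemma desc_lt M (X : {set 'I_M}) x : x \in desc X -> (x < M)%N.
Proof. by rewrite mem_rev => /mapP[y _ ->]; exact: ltn_ord. Qed.

Lemma desc_sorted M (X : {set 'I_M}) : sorted gtn (desc X).
Proof.
rewrite rev_sorted; apply: (@subseq_sorted _ ltn ltn_trans _ (map val (enum 'I_M))).
  by rewrite map_subseq // /enum_mem filter_predT filter_subseq.
by rewrite val_enum_ord iota_ltn_sorted.
Qed.

Lemma desc_eq M (X : {set 'I_M}) l : sorted gtn l ->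
  (forall x, x \in l -> (x < M)%N) -> (forall x : 'I_M, ((x : nat) \in l) = (x \in X)) ->
  l = desc X.
Proof.
move=> srt lt_M mem_l; apply: (irr_sorted_eq gtn_tr) => //; last 2 first.
- exact: desc_sorted.
- move=> x; apply/idP/idP => [x_l|x_X].
    by have := x_l; rewrite -[x]/(val (Ordinal (lt_M x x_l))) mem_l mem_desc.
  by have := x_X; rewrite -[x]/(val (Ordinal (desc_lt x_X))) mem_l mem_desc.
by move=> x /=; rewrite ltnn.
Qed.

Lemma big_desc (R : Type) (idx : R) (op : Monoid.com_law idx) M (X : {set 'I_M})
    (P : pred nat) (F : nat -> R) :
  \big[op/idx]_(x <- desc X | P x) F x = \big[op/idx]_(x in X | P x) F x.
Proof. by rewrite big_rev big_map big_enum_cond. Qed.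

Lemma sumn_desc M (X : {set 'I_M}) : sumn (desc X) = (\sum_(x in X) x)%N.
Proof. by rewrite sumnE big_rev big_map big_enum. Qed.

Lemma decr_map l x : uniq l -> x \in l ->
  decr l (index x l) = [seq if z == x then z.-1 else z | z <- l].
Proof.
move=> ul x_l; apply: (@eq_from_nth _ 0%N) => [|i].
  by rewrite size_decr ?index_mem // size_map.
rewrite size_decr ?index_mem // => lt_i; rewrite nth_decr (nth_map 0%N) //.
rewrite -[in RHS](nth_index 0%N x_l) nth_uniq ?index_mem //.
by case: eqP => [->|]; rewrite ?subn1 ?subn0.
Qed.

(** The entry following b = a + 1 is not a, so it is smaller than a, and the list stays strictly
    decreasing when b drops to a. *)
Lemma decr_desc M (X : {set 'I_M}) (a b : 'I_M) : b = a.+1 :> nat -> b \in X ->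
  a \notin X -> decr (desc X) (index (b : nat) (desc X)) = desc (a |: X :\ b).
Proof.
move=> def_b bX aX; have b_l : (b : nat) \in desc X by rewrite mem_desc.
have srt := desc_sorted X; have ul := gtn_sorted_uniq srt.
apply: desc_eq => [|x|x].
- apply/(sortedP 0%N) => i; rewrite size_decr ?index_mem // => lt_i /=.
  have /= lt_iS := sortedP 0%N srt i lt_i; rewrite !nth_decr.
  case: (eqVneq i) => [def_i|_]; last by case: (i.+1 == _) => /=; lia.
  have ne_a : nth 0%N (desc X) i.+1 != a.
    apply/eqP=> def_a; have := mem_nth 0%N lt_i.
    by rewrite def_a mem_desc (negPf aX).
  have nth_i : nth 0%N (desc X) i = a.+1 by rewrite def_i nth_index.
  by move: lt_iS ne_a; rewrite nth_i; case: (i.+1 == _) => /=; lia.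
- rewrite decr_map // => /mapP[z z_l ->]; have := desc_lt z_l; case: ifP; lia.
rewrite decr_map // !inE; apply/mapP/orP => [[z z_l]|[/eqP->|/andP[ne_xb xX]]].
- case: eqP => [->|/eqP ne_zb] def_x.
    by left; apply/eqP/val_inj; rewrite /= def_x def_b.
  by right; rewrite -(mem_desc X) def_x z_l andbT -val_eqE /= def_x.
- by exists (b : nat) => //; rewrite eqxx def_b.
- by exists (x : nat); rewrite ?mem_desc // val_eqE (negPf ne_xb).
Qed.

(** This is [weight_decr] for the list of X: lowering b to a = b - 1 exchanges elements if a is not
    in X, and otherwise yields a repeated entry, of weight 0. *)
Lemma weight_desc_step M (X : {set 'I_M}) :
  \sum_(a : 'I_M) \sum_(b : 'I_M | [&& b == a.+1 :> nat, b \in X & a \notin X])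
     weight (desc (a |: X :\ b)) =
  ((\sum_(x in X) x)%N%:R - 'C(#|X|, 2)%:R) * weight (desc X).
Proof.
have ul := gtn_sorted_uniq (desc_sorted X).
rewrite -sumn_desc -size_desc -weight_decr.
transitivity (\sum_(x <- desc X | (0 < x)%N) weight (decr (desc X) (index x (desc X)))); last first.
  rewrite (big_nth 0%N) big_mkord; apply: eq_bigr => i _.
  by rewrite index_uniq.
rewrite big_desc (exchange_big_dep (fun b : 'I_M => (b \in X) && (0 < b)%N)) /=; last first.
  by move=> a b _ /and3P[/eqP-> ->].
apply: eq_bigr => b /andP[bX b_gt0].
have lt_a : (b.-1 < M)%N by have := ltn_ord b; lia.
pose a := Ordinal lt_a; have def_b : b = a.+1 :> nat by rewrite /= prednK.
have [aX|aX] := boolP (a \in X).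
  rewrite big_pred0 => [|a']; last first.
    apply/negbTE/and3P=> -[/eqP eq_b _]; have -> : a' = a by apply/val_inj; rewrite /=; lia.
    by rewrite aX.
  rewrite weight_eq0 //; apply/negP => /(uniqP 0%N)/(_ (index (a : nat) (desc X)) (index (b : nat) (desc X))).
  have [a_l b_l] : (a : nat) \in desc X /\ (b : nat) \in desc X by rewrite !mem_desc.
  rewrite !inE size_decr !index_mem // => /(_ a_l b_l).
  rewrite !nth_decr !nth_index // eqxx.
  have ne_i : (index (a : nat) (desc X) == index (b : nat) (desc X)) = false.
    apply/eqP=> /(congr1 (nth 0%N (desc X))); rewrite !nth_index //=; lia.
  by rewrite ne_i subn0 subn1 => /(_ erefl) /eqP; rewrite ne_i.
rewrite (big_pred1 a) => [|a']; first by rewrite -decr_desc.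
rewrite bX; apply/andP/eqP => [[/eqP eq_b _]|->]; last by rewrite def_b.
by apply/val_inj; rewrite /=; lia.
Qed.

(** * Exchanges between a set and its complement *)

Section SwapElements.
Variables (T : finType) (a b : T) (X : {set T}).

Lemma swap_elemK : a != b ->
  (b |: (a |: X :\ b) :\ a == X) = (b \in X) && (a \notin X).
Proof.
move=> ne_ab; apply/eqP/andP => [<-|[bX aX]].
  by rewrite !inE !eqxx (negPf ne_ab).
apply/setP=> x; rewrite !inE; case: (eqVneq x b) => [->|nxb] //=.
by case: (eqVneq x a) => [->|//]; rewrite (negPf aX).
Qed.

Hypotheses (bX : b \in X) (aX : a \notin X).

Lemma swap_elem_setC : a |: ~: (a |: X :\ b) :\ b = ~: X.
Proof.
apply/setP=> x; rewrite !inE; case: (eqVneq x a) => [->|nxa] //=.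
by case: (eqVneq x b) => [->|//]; rewrite bX.
Qed.

Lemma sum_swap_elem (F : T -> nat) :
  (\sum_(x in a |: X :\ b) F x + F b = \sum_(x in X) F x + F a)%N.
Proof.
rewrite big_setU1 /=; last by rewrite !inE (negPf aX) andbF.
rewrite [X in (_ = X + _)%N](big_setD1 b) //=; lia.
Qed.

Lemma card_swap_elem : #|a |: X :\ b| = #|X|.
Proof. by have := sum_swap_elem (fun=> 1%N); rewrite !sum1_card => /addIn. Qed.

End SwapElements.

(** When X is the set of beta-numbers of la, prescribing the sum c amounts to prescribing |la| = c -
    C(m, 2). *)
Definition pair_sum (M m c : nat) : rat :=
  \sum_(X : {set 'I_M} | (#|X| == m) && ((\sum_(x in X) x)%N == c))
     weight (desc X) * weight (desc (~: X)).

Lemma sum_setC M (X : {set 'I_M}) :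
  (\sum_(x in X) x + \sum_(x in ~: X) x = 'C(M, 2))%N.
Proof.
rewrite -bin2_sum big_mkord [RHS](bigID (mem X)) /=; congr (_ + _)%N.
by apply: eq_bigl => x; rewrite inE.
Qed.

(* Both sides count, with weights, the ways of replacing an element a of X by
   b = a + 1; the complement of X then trades b for a. *)
Lemma pair_sum_step M m c : (m <= M)%N ->
  ('C(M, 2)%:R - c%:R - 'C(M - m, 2)%:R) * pair_sum M m c =
  (c.+1%:R - 'C(m, 2)%:R) * pair_sum M m c.+1.
Proof.
move=> le_mM; rewrite /pair_sum !mulr_sumr.
(* Here [weight_desc_step] is applied to the complement, whose M - m elements sum to C(M, 2) - c; on
   the other side it is applied to X. *)
transitivity (\sum_(X : {set 'I_M} | (#|X| == m) && ((\sum_(x in X) x)%N == c))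
   \sum_(a : 'I_M) \sum_(b : 'I_M | [&& b == a.+1 :> nat, b \in ~: X & a \notin ~: X])
     weight (desc X) * weight (desc (a |: ~: X :\ b))).
  apply: eq_bigr => X /andP[/eqP cardX /eqP sumX].
  under eq_bigr => a _ do rewrite -mulr_sumr.
  rewrite -mulr_sumr weight_desc_step mulrCA; congr (_ * (_ * _)).
  by rewrite -(sum_setC X) sumX natrD [c%:R + _]addrC addrK cardsCs setCK card_ord cardX.
transitivity (\sum_(X : {set 'I_M} | (#|X| == m) && ((\sum_(x in X) x)%N == c.+1))
   \sum_(a : 'I_M) \sum_(b : 'I_M | [&& b == a.+1 :> nat, b \in X & a \notin X])
     weight (desc (a |: X :\ b)) * weight (desc (~: X))); last first.
  apply: eq_bigr => X /andP[/eqP cardX /eqP sumX].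
  under eq_bigr => a _ do rewrite -mulr_suml.
  by rewrite -mulr_suml weight_desc_step -mulrA cardX sumX.
rewrite exchange_big [RHS]exchange_big; apply: eq_bigr => a _ /=.
rewrite (exchange_big_dep (fun b : 'I_M => b == a.+1 :> nat)) /=; last by move=> ? ? _ /and3P[].
rewrite [RHS](exchange_big_dep (fun b : 'I_M => b == a.+1 :> nat)) /=; last by move=> ? ? _ /and3P[].
apply: eq_bigr => b /eqP def_b; have ne_ab : a != b by rewrite -val_eqE /= def_b; lia.
(* The swap carries the sets of sum c + 1 containing b but not a onto the sets of sum c containing a
   but not b. *)
rewrite (reindex_onto (fun X => a |: X :\ b) (fun X => b |: X :\ a)) /=; last first.
  move=> X /andP[_]; rewrite !inE negbK => /and3P[_ bX aX].
  by apply/eqP; rewrite swap_elemK 1?eq_sym // aX bX.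
apply: eq_big => [X|X].
  rewrite swap_elemK // !inE !eqxx (eq_sym b) (negPf ne_ab) /=.
  case: (boolP (b \in X)) => bX; rewrite ?andbF //=.
  case: (boolP (a \in X)) => aX; rewrite ?andbF //= !andbT card_swap_elem //.
  have := sum_swap_elem bX aX (fun x : 'I_M => x : nat); rewrite def_b => sumX.
  rewrite eqxx !andbT; congr (_ && _).
  by rewrite -(eqn_add2r a.+1) sumX addnS -addSn eqn_add2r.
by rewrite swap_elemK // => /andP[_ /andP[bX aX]]; rewrite swap_elem_setC.
Qed.

(** Inverse of [beta]: the truncated subtraction is exact on strictly decreasing sequences. *)
Fixpoint unbeta (l : seq nat) : seq nat :=
  if l is x :: l' then (x - size l')%N :: unbeta l' else [::].

Lemma size_unbeta l : size (unbeta l) = size l.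
Proof. by elim: l => //= x l ->. Qed.

Lemma betaK s : unbeta (beta s) = s.
Proof. by elim: s => //= x s ->; rewrite size_beta addnK. Qed.

Lemma path_gtn_size x l : path gtn x l -> (size l <= x)%N.
Proof.
by elim: l x => //= y l IHl x /andP[lt_yx /IHl le_y]; apply: leq_ltn_trans lt_yx.
Qed.

Lemma unbetaK l : sorted gtn l -> beta (unbeta l) = l.
Proof.
elim: l => //= x l IHl srt; rewrite size_unbeta subnK ?path_gtn_size //.
by rewrite IHl // (path_sorted srt).
Qed.

Lemma beta_sorted s : is_part s -> sorted gtn (beta s).
Proof.
elim: s => //= x s IHs srt; have := IHs (path_sorted srt).
case: s srt {IHs} => //= y s /andP[le_yx _] ->; rewrite andbT; move: le_yx => /=; lia.
Qed.

Lemma unbeta_part l : sorted gtn l -> is_part (unbeta l).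
Proof.
rewrite /is_part; elim: l => //= x l IHl srt; have := IHl (path_sorted srt).
case: l srt {IHl} => //= y l /andP[lt_yx _] ->; rewrite andbT; move: lt_yx => /=; lia.
Qed.

Lemma unbeta_le n l : sorted gtn l -> all (gtn (n + size l)%N) l -> all (geq n) (unbeta l).
Proof.
elim: l => //= x l IHl srt /andP[lt_x _]; apply/andP; split; first by move: lt_x => /=; lia.
apply: IHl; first exact: path_sorted srt.
apply/allP => y y_l; have /allP/(_ y y_l) /= := order_path_min gtn_tr srt.
by move: lt_x => /=; lia.
Qed.

Lemma beta_lt n s : is_part s -> all (geq n) s -> all (gtn (n + size s)%N) (beta s).
Proof.
move=> srt; elim: s srt => //= x s IHs srt /andP[le_x le_s].
apply/andP; split; first by move: le_x => /=; lia.
apply: sub_all (IHs (path_sorted srt) le_s) => y /=; lia.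
Qed.

Lemma map_succ_beta p s : size s = p -> map succn (beta s) = part_add s (stair p).
Proof.
move=> sz; apply: (@eq_from_nth _ 0%N) => [|i].
  by rewrite size_map size_beta size_part_add_stair.
rewrite size_map size_beta sz => lt_i.
rewrite (nth_map 0%N) ?size_beta ?sz // nth_beta ?sz // nth_part_add_stair //.
by lia.
Qed.

Lemma box_seq m n (la : m.-tuple 'I_n.+1) :
  size (map val la) = m /\ all (geq n) (map val la).
Proof.
split; first by rewrite size_map size_tuple.
by apply/allP => _ /mapP[x _ ->]; rewrite /= -ltnS.
Qed.

Section BoxPartitions.
Variables (m n : nat).

Definition beta_set (s : seq nat) : {set 'I_(m + n)} := [set x : 'I_(m + n) | (x : nat) \in beta s].

Lemma desc_beta_set s : is_part s -> size s = m -> all (geq n) s ->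
  desc (beta_set s) = beta s.
Proof.
move=> srt sz le_n; apply/esym/desc_eq => [|x|x]; first exact: beta_sorted.
  by move=> x_s; have /allP/(_ x x_s) := beta_lt srt le_n; rewrite sz /= addnC.
by rewrite inE.
Qed.

(** Subtracting 1 from the parts of la + [m] gives its beta-numbers, so the complement in {1, ..., m
    + n} that defines la^c becomes the complement in {0, ..., m + n - 1}. *)
Lemma beta_part_compl s : is_part s -> size s = m -> all (geq n) s ->
  beta (part_compl m n s) = desc (~: beta_set s).
Proof.
move=> srt sz le_n; have [srt_c sz_c _] := part_complP srt sz le_n.
have := map_succ_beta sz_c; rewrite part_add_part_compl // => eq_map.
have mem_c x : (x \in beta (part_compl m n s)) = (x < m + n)%N && (x \notin beta s).
  by rewrite -(mem_map succn_inj) eq_map mem_compl_strict ltnS -(map_succ_beta sz) (mem_map succn_inj).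
apply: desc_eq => [|x|x]; first exact: beta_sorted.
  by rewrite mem_c => /andP[].
by rewrite mem_c ltn_ord !inE.
Qed.

(** The bijection between box partitions and m-subsets; G is arbitrary so that it can also encode a
    condition on |la|. *)
Lemma sum_box_partitions (R : nmodType) (G : seq nat -> seq nat -> R) :
  \sum_(la : m.-tuple 'I_n.+1 | is_part (map val la))
     G (beta (map val la)) (beta (part_compl m n (map val la))) =
  \sum_(X : {set 'I_(m + n)} | #|X| == m) G (desc X) (desc (~: X)).
Proof.
pose h (la : m.-tuple 'I_n.+1) := beta_set (map val la).
pose h' (X : {set 'I_(m + n)}) : m.-tuple 'I_n.+1 :=
  [tuple inord (nth 0%N (unbeta (desc X)) i) | i < m].
have h'E (X : {set 'I_(m + n)}) : #|X| = m -> map val (h' X) = unbeta (desc X).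
  move=> cX; have sz : size (unbeta (desc X)) = m by rewrite size_unbeta size_desc.
  have /(all_nthP 0%N) le_n : all (geq n) (unbeta (desc X)).
    apply: unbeta_le; first exact: desc_sorted.
    by apply/allP => x /desc_lt; rewrite size_desc cX /= addnC.
  apply: (@eq_from_nth _ 0%N) => [|i]; first by rewrite size_map size_tuple.
  rewrite size_map size_tuple => lt_i; rewrite (nth_map ord0) ?size_tuple //.
  rewrite -[i]/(nat_of_ord (Ordinal lt_i)) -tnth_nth tnth_mktuple /= inordK //.
  by rewrite ltnS; apply: le_n; rewrite sz.
have h'K (X : {set 'I_(m + n)}) : #|X| = m -> h (h' X) = X.
  move=> cX; apply/setP=> x; rewrite inE h'E // unbetaK ?desc_sorted //.
  by rewrite mem_desc.
rewrite [RHS](reindex_onto h h') => [|X /eqP/h'K //].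
apply: eq_big => [la|la srt]; have [sz le_n] := box_seq la; last first.
  by rewrite desc_beta_set // beta_part_compl.
(* Every [h' X] with X of m elements is weakly decreasing, so the round trip condition singles out
   the partitions. *)
apply/idP/andP => [srt|[/eqP c_la /eqP <-]]; last first.
  by rewrite h'E // unbeta_part // desc_sorted.
have c_la : #|h la| = m by rewrite -size_desc desc_beta_set // size_beta.
rewrite c_la eqxx; split=> //; apply/eqP/val_inj/(inj_map val_inj) => /=.
by rewrite h'E // desc_beta_set // betaK.
Qed.

End BoxPartitions.

(** * The summation formula *)

(** These are the coefficients of x^N in (1 - x)^(-a-1) (1 - x)^(-b-1). The proof is a double
    induction with Pascal's rule. *)
Lemma sum_bin_conv a b N :
  (\sum_(t < N.+1) 'C(a + t, t) * 'C(b + (N - t), N - t) = 'C(a + b + N + 1, N))%N.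
Proof.
elim: a N => [|a IHa] N.
  rewrite add0n; elim: N => [|N IHN]; first by rewrite big_ord1 subn0 !bin0.
  rewrite big_ord_recl subn0 bin0 mul1n.
  transitivity ('C(b + N.+1, N.+1) + \sum_(t < N.+1) 'C(0 + t, t) * 'C(b + (N - t), N - t))%N.
    by congr (_ + _)%N; apply: eq_bigr => t _; rewrite lift0 !add0n !binn subSS.
  by rewrite IHN !addn1 addnS [RHS]binS.
elim: N => [|N IHN]; first by rewrite big_ord1 subn0 !bin0.
have -> : (a.+1 + b + N.+1 + 1 = (a + b + N.+1 + 1).+1)%N by lia.
rewrite binS -IHa.
have -> : (a + b + N.+1 + 1 = a.+1 + b + N + 1)%N by lia.
rewrite -IHN [LHS]big_ord_recl [in RHS]big_ord_recl /= -addnA; congr (_ + _)%N.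
  by rewrite !bin0.
rewrite -big_split; apply: eq_bigr => t _ /=.
rewrite /bump !add1n subSS -mulnDl; congr (_ * _)%N.
by rewrite -addSnnS binS addnS.
Qed.

Lemma bin2D m n : 'C(m + n, 2) = ('C(m, 2) + 'C(n, 2) + m * n)%N.
Proof. by elim: m => [|m IHm]; rewrite ?addn0 // addSn !binS IHm !bin1; lia. Qed.

(** The beta-numbers of both partitions together sum to C(m + n, 2); removing C(m, 2) and C(n, 2)
    leaves mn. *)
Lemma sumn_part_compl m n s : is_part s -> size s = m -> all (geq n) s ->
  (sumn s + sumn (part_compl m n s) = m * n)%N.
Proof.
move=> srt sz le_n; have [_ sz_c _] := part_complP srt sz le_n.
have := sum_setC (beta_set m n s).
rewrite -!sumn_desc -beta_part_compl // desc_beta_set // !sumn_beta sz sz_c bin2D.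
lia.
Qed.

Lemma sumn_rect_part m n : sumn (rect_part m n) = (m * n)%N.
Proof. by rewrite sumn_nseq mulnC. Qed.

Lemma is_part_rect m n : is_part (rect_part m n).
Proof.
apply/(sortedP 0%N) => i; rewrite size_nseq /= !nth_nseq => lt_i.
by rewrite lt_i (ltnW lt_i).
Qed.

Lemma sumn_le_box n s : all (geq n) s -> (sumn s <= size s * n)%N.
Proof. by elim: s => //= x s IHs /andP[le_x /IHs]; move: le_x => /=; lia. Qed.

Lemma sumn_full_box n s : all (geq n) s -> sumn s = (size s * n)%N -> s = nseq (size s) n.
Proof.
elim: s => //= x s IHs /andP[le_x le_s] sum_s.
have := sumn_le_box le_s; move: le_x => /= le_x le_sum.
have eq_x : x = n by lia.
by rewrite eq_x -IHs //; lia.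
Qed.

Definition box_pair_sum (m n t : nat) : rat :=
  \sum_(la : m.-tuple 'I_n.+1 | is_part (map val la) && (sumn (map val la) == t))
     weight (beta (map val la)) * weight (beta (part_compl m n (map val la))).

Lemma box_pair_sumE m n t :
  box_pair_sum m n t = pair_sum (m + n) m (t + 'C(m, 2)).
Proof.
rewrite /pair_sum big_mkcondr.
pose G l l' : rat := if sumn l == (t + 'C(m, 2))%N then weight l * weight l' else 0.
transitivity (\sum_(X : {set 'I_(m + n)} | #|X| == m) G (desc X) (desc (~: X))); last first.
  by apply: eq_bigr => X _; rewrite /G sumn_desc.
rewrite -sum_box_partitions /box_pair_sum big_mkcondr; apply: eq_bigr => la _.
by have [sz _] := box_seq la; rewrite /G sumn_beta sz eqn_add2r.
Qed.

(** Only the full rectangle has size mn, and its complement is empty, of weight 1. *)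
Lemma box_pair_sum_full m n :
  box_pair_sum m n (m * n) = (nSYT (rect_part m n))%:R / ((m * n)`!)%:R.
Proof.
rewrite nSYT_weight ?is_part_rect // sumn_rect_part mulrAC divff ?natr_fact_neq0 // mul1r.
pose full : m.-tuple 'I_n.+1 := [tuple of nseq m ord_max].
have full_seq : map val full = rect_part m n by rewrite map_nseq.
rewrite /box_pair_sum (big_pred1 full) => [|la]; last first.
  have [sz le_n] := box_seq la.
  apply/andP/eqP => [[_ /eqP sum_la]|->]; last by rewrite full_seq is_part_rect sumn_rect_part.
  apply/val_inj/(inj_map val_inj); rewrite full_seq (sumn_full_box le_n) sz //.
have [sz le_n] := box_seq full; rewrite full_seq in sz le_n *.
have [_ sz_c _] := part_complP (is_part_rect m n) sz le_n.
have := sumn_part_compl (is_part_rect m n) sz le_n; rewrite sumn_rect_part.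
rewrite -[RHS]addn0 => /addnI/sumn0_nseq->.
by rewrite sz_c weight_staircase mulr1.
Qed.

(** Descending induction on t from the full rectangle, with d = mn - t as induction variable. *)
Lemma box_pair_sum_fact m n t : (t <= m * n)%N ->
  box_pair_sum m n t = (nSYT (rect_part m n))%:R / ((t`!)%:R * ((m * n - t)`!)%:R).
Proof.
move=> le_t; rewrite -(subKn le_t); elim: (m * n - t)%N (leq_subr t (m * n)) => {t le_t}[|d IHd] le_d.
  by rewrite subn0 subnn fact0 mulr1 box_pair_sum_full.
set t := (m * n - d.+1)%N.
have eq_t : (m * n - d = t.+1)%N by rewrite /t; lia.
have := pair_sum_step (t + 'C(m, 2)) (leq_addr n m).
rewrite -addSn -!box_pair_sumE addKn -eq_t (IHd (ltnW le_d)) (subKn le_d) (subKn (ltnW le_d)) eq_t.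
(* By [bin2D] the coefficient in [pair_sum_step] reduces to mn - t. *)
have -> : 'C(m + n, 2)%:R - (t + 'C(m, 2))%:R - 'C(n, 2)%:R = d.+1%:R :> rat.
  by rewrite bin2D !natrD [t%:R]natrB //; ring.
have -> : (t.+1 + 'C(m, 2))%:R - 'C(m, 2)%:R = t.+1%:R :> rat by rewrite natrD addrK.
have d_neq0 : d.+1%:R != 0 :> rat by rewrite pnatr_eq0.
have t_neq0 : t.+1%:R != 0 :> rat by rewrite pnatr_eq0.
move=> step; apply: (mulfI d_neq0); rewrite step !factS !natrM.
field.
by rewrite !natr_fact_neq0 !nat1r d_neq0 t_neq0.
Qed.

(** * Weights of concatenated shapes *)

Lemma vdm_cat l1 l2 :
  vdm (l1 ++ l2) = vdm l1 * \prod_(x <- l1) \prod_(y <- l2) (x%:R - y%:R) * vdm l2.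
Proof.
elim: l1 => [|x l1 IHl] /=; first by rewrite big_nil !mul1r.
by rewrite IHl big_cat big_cons /= -!mulrA; congr (_ * _); rewrite mulrCA.
Qed.

(* X and its complement together contribute prod_(z < M) (a - z) for each a in
   A, which no longer depends on X. *)
Lemma weight_shift_cat M B (X : {set 'I_M}) (A := map (addn^~ M) B) :
  weight (A ++ desc X) * weight (A ++ desc (~: X)) =
  weight B * weight A * (weight (desc X) * weight (desc (~: X))).
Proof.
have vdmA : vdm A = vdm B.
  rewrite /A; elim: (B) => //= x l ->; rewrite big_map; congr (_ * _).
  by apply: eq_bigr => y _; rewrite !natrD; ring.
(* X and its complement run over all z < M, so this is the falling factorial (a + M) ... (a + 1). *)
have prodA (a : nat) : \prod_(x <- desc X) ((a + M)%:R - x%:R) *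
    \prod_(x <- desc (~: X)) ((a + M)%:R - x%:R) = ((a + M)`!)%:R / (a`!)%:R :> rat.
  apply: (canRL (mulfK (natr_fact_neq0 a))).
  have := ffact_fact (leq_addl a M); rewrite addnK => <-.
  rewrite natrM ffact_prod natr_prod !big_desc [in RHS](bigID (mem X)) /=.
  congr (_ * _ * _); apply: eq_big => [x|x _]; rewrite ?inE ?andbT //;
    by rewrite natrB // ltnW // (leq_trans (ltn_ord x)) ?leq_addl.
have prod_all : \prod_(x <- A) \prod_(y <- desc X) (x%:R - y%:R) *
    \prod_(x <- A) \prod_(y <- desc (~: X)) (x%:R - y%:R) =
    \prod_(x <- A) (x`!)%:R / \prod_(x <- B) (x`!)%:R :> rat.
  rewrite !big_map -big_split -prodf_div; apply: eq_bigr => a _ /=; exact: prodA.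
rewrite /weight !vdm_cat !big_cat vdmA /=.
have := (prod_fact_neq0 A, prod_fact_neq0 B, prod_fact_neq0 (desc X), prod_fact_neq0 (desc (~: X))).
move: prod_all.
set PX := \prod_(x <- A) \prod_(y <- desc X) _.
set PY := \prod_(x <- A) \prod_(y <- desc (~: X)) _.
set fA := \prod_(x <- A) _; set fB := \prod_(x <- B) _.
set fX := \prod_(x <- desc X) _; set fY := \prod_(x <- desc (~: X)) _.
move=> prod_all [[[fA0 fB0] fX0] fY0].
(* The cross products enter only through PX * PY = fA / fB, which trades a factor fA of the
   denominator for fB. *)
transitivity ((PX * PY) * (vdm B * vdm B * vdm (desc X) * vdm (desc (~: X)) / (fA * fA * fX * fY))).
  by field; rewrite fA0 fX0 fY0.
by rewrite prod_all; field; rewrite fA0 fB0 fX0 fY0.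
Qed.

Lemma beta_cat s1 s2 : beta (s1 ++ s2) = map (addn^~ (size s2)) (beta s1) ++ beta s2.
Proof. by elim: s1 => //= x s1 ->; rewrite size_cat addnA. Qed.

Lemma beta_shift n s : beta (map (addn^~ n) s) = map (addn^~ n) (beta s).
Proof. by elim: s => //= x s ->; rewrite size_map addnAC. Qed.

Lemma part_add_rect k n s : size s = k -> part_add s (rect_part k n) = map (addn^~ n) s.
Proof.
move=> sz; apply: (@eq_from_nth _ 0%N) => [|i]; rewrite size_mkseq size_nseq sz maxnn ?size_map ?sz //.
move=> lt_i; rewrite nth_mkseq ?sz ?size_nseq ?maxnn // (nth_map 0%N) ?sz //.
by rewrite nth_nseq lt_i.
Qed.

Lemma sumn_shift n s : sumn (map (addn^~ n) s) = (sumn s + size s * n)%N.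
Proof. by elim: s => //= x s ->; rewrite mulSn; lia. Qed.

Lemma is_part_shift n s : is_part s -> is_part (map (addn^~ n) s).
Proof.
by apply: homo_sorted => x y /=; rewrite leq_add2r.
Qed.

Lemma is_part_cat n s1 s2 : is_part s1 -> is_part s2 ->
  all (leq n) s1 -> all (geq n) s2 -> is_part (s1 ++ s2).
Proof.
rewrite /is_part !(sorted_pairwise geq_tr) pairwise_cat => -> -> /allP ge_n /allP le_n.
rewrite andbT andbT; apply/allrelP => x y /ge_n /= le_nx /le_n /=; lia.
Qed.

(** The l-sequence of s1 moves by n from the added columns and by [size s2] from the rows below. For
    la and la^c the total shift is m + n alike, as [weight_shift_cat] requires. *)
Lemma nSYT_shift_cat n s1 s2 : is_part s1 -> is_part s2 -> all (geq n) s2 ->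
  (nSYT (map (addn^~ n) s1 ++ s2))%:R =
  ((sumn s1 + size s1 * n + sumn s2)`!)%:R *
  weight (map (addn^~ (size s2 + n)%N) (beta s1) ++ beta s2).
Proof.
move=> srt1 srt2 le_n; rewrite nSYT_weight; last first.
  apply: is_part_cat le_n => //; first exact: is_part_shift.
  by apply/allP => _ /mapP[x _ ->]; rewrite leq_addl.
rewrite sumn_cat sumn_shift beta_cat beta_shift -map_comp; congr (_ * weight (_ ++ _)).
by apply: eq_map => x /=; rewrite addnAC addnA.
Qed.

Lemma nSYT_pair m n mu la : is_part mu -> is_part la -> size la = m -> all (geq n) la ->
  (nSYT (map (addn^~ n) mu ++ la))%:R * (nSYT (map (addn^~ m) mu ++ part_compl m n la))%:R =
  ((sumn mu + size mu * n + sumn la)`!)%:R *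
  ((sumn mu + size mu * m + (m * n - sumn la))`!)%:R *
  (weight (beta mu) * weight (map (addn^~ (m + n)%N) (beta mu)) *
   (weight (beta la) * weight (beta (part_compl m n la)))).
Proof.
move=> srt_mu srt sz le_n; have [srt_c sz_c _] := part_complP srt sz le_n.
have sum_c := sumn_part_compl srt sz le_n.
(* The n beta-numbers of la^c lie below m + n, so its parts are at most m. *)
have le_m : all (geq m) (part_compl m n la).
  have : all (gtn (m + n)%N) (beta (part_compl m n la)).
    by rewrite beta_part_compl //; apply/allP => x /desc_lt.
  by rewrite -{1}sz_c => lt_c; rewrite -(betaK (part_compl _ _ _)) unbeta_le ?size_beta ?beta_sorted.
rewrite !nSYT_shift_cat // sz sz_c (addnC n m) mulrACA.
by rewrite beta_part_compl // -(desc_beta_set srt sz le_n) weight_shift_cat -sum_c addKn.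
Qed.

Theorem theorem5p5 (m n k : nat) (mu : k.-tuple nat) (hmu : is_part mu) :
  (\sum_(la : m.-tuple 'I_n.+1 | is_part (map val la))
     nSYT (part_add mu (rect_part k n) ++ map val la) *
     nSYT (part_add mu (rect_part k m) ++ part_compl m n (map val la)))%N%:R
  = (nSYT (part_add mu (rect_part k (m + n))))%:R
    * (nSYT mu)%:R
    * (nSYT (rect_part m n))%:R
    * ('C(m * n + 2 * sumn mu + m * k + n * k + 1, m * n))%:R
    * (((sumn mu + m * k)`! * (sumn mu + n * k)`!)%N%:R
       / ((sumn mu + m * k + n * k)`! * (sumn mu)`!)%N%:R) :> rat.
Proof.
have sz := size_tuple mu; rewrite !part_add_rect //.
(* The partitions are grouped by their size t, which is at most mn. *)
rewrite natr_sum (partition_big (fun la : m.-tuple 'I_n.+1 => inord (sumn (map val la)) : 'I_(m * n).+1) xpredT) //=.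
set w := weight (beta mu) * weight (map (addn^~ (m + n)%N) (beta mu)).
pose a := (sumn mu + k * n)%N; pose b := (sumn mu + k * m)%N.
transitivity (\sum_(t < (m * n).+1)
   ((a + t)`!)%:R * ((b + (m * n - t))`!)%:R * (w * box_pair_sum m n t)).
  apply: eq_bigr => t _; rewrite !mulr_sumr; apply: eq_big => [la|la /andP[srt /eqP]].
    have [sz_la le_n] := box_seq la; rewrite -val_eqE /= inordK // ltnS -{2}sz_la.
    exact: sumn_le_box.
  have [sz_la le_n] := box_seq la; move/(congr1 val) => /=; rewrite inordK; last first.
    by rewrite ltnS -{2}sz_la sumn_le_box.
  by move=> <-; rewrite natrM nSYT_pair // sz.
transitivity (w * (nSYT (rect_part m n))%:R * (a`!)%:R * (b`!)%:R *
   (\sum_(t < (m * n).+1) 'C(a + t, t) * 'C(b + (m * n - t), m * n - t))%N%:R).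
  rewrite natr_sum mulr_sumr; apply: eq_bigr => t _.
  have le_t : (t <= m * n)%N by rewrite -ltnS.
  rewrite box_pair_sum_fact // natrM.
  (* This splits off t! and (mn - t)!, which cancel the denominator of S_t and leave the binomials
     of the convolution. *)
  have fact_bin c d : ((c + d)`!)%:R = 'C(c + d, d)%:R * ((d`!)%:R * (c`!)%:R) :> rat.
    by rewrite -!natrM -(bin_fact (leq_addl c d)) addnK.
  by rewrite !fact_bin; field; rewrite !natr_fact_neq0.
rewrite sum_bin_conv.
have -> : (a + b + m * n + 1 = m * n + 2 * sumn mu + m * k + n * k + 1)%N by rewrite /a /b; lia.
(* The two weights in w are those of mu and mu + ((m + n)^k); the factorials of these two shapes
   cancel the denominator on the right. *)
rewrite (nSYT_weight hmu) (nSYT_weight (is_part_shift _ hmu)) sumn_shift beta_shift sz.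
have -> : (sumn mu + k * (m + n) = sumn mu + m * k + n * k)%N by lia.
have -> : (sumn mu + m * k = b)%N by rewrite /b mulnC.
have -> : (sumn mu + n * k = a)%N by rewrite /a mulnC.
rewrite /w !natrM; field.
by rewrite !natr_fact_neq0.
Qed.
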